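(* Let $G$ be a finite simple graph with non-empty edge set, let $K$ be a field and let $A(G)=K[E_G]/I(G)$ be the Eulerian Artinian algebra of $G$. The socle degrees of $A(G)$ (counted with multiplicity) are given by $\tau(T,p)$, for $(T,p)$ varying in the set of socle pairs of $G$. Alternatively, fixing an ordering of $E_G$, the socle degrees of $A(G)$ (counted with multiplicity) are the cardinalities of the reduced parity joins $J\subseteq E_G$ such that $\mathbf{t}_J t_e\in I(G)$ for all $e\in E_G$, or, equivalently, the cardinalities of the reduced parity joins that are maximal, with respect to inclusion, in the set of all parity joins of $G$.
   Context: $G$ is a finite simple undirected graph with vertex set $V_G$ and non-empty edge set $E_G$ (each edge is a 2-element subset of $V_G$); $K$ is any field. $K[E_G]=K[t_e : e\in E_G]$ is the standard graded polynomial ring, with irrelevant ideal $\mathfrak m=(t_e: e\in E_G)$. For $J\subseteq E_G$, $\mathbf{t}_J=\prod_{e\in J}t_e$. $\triangle$ denotes symmetric difference of sets. For $C\subseteq E_G$ and $v\in V_G$, $\deg_C(v)$ is the number of edges of $C$ containing $v$. $C$ is Eulerian if $\deg_C(v)$ is even for every $v\in V_G$. An Eulerian binomial is $\mathbf{t}_J-\mathbf{t}_L$ where $J,L\subseteq E_G$ are non-empty, $J\cap L=\emptyset$, $|J|=|L|$ and $J\cup L$ is Eulerian. $I(G)$ is the ideal of $K[E_G]$ generated by all Eulerian binomials and all $t_e^2$, $e\in E_G$; $A(G)=K[E_G]/I(G)$. The socle of $A(G)$ is the graded submodule $\{u\in A(G) : \mathfrak m u=0\}$; the socle degrees are the degrees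 of the elements of a minimal homogeneous generating set (equivalently a homogeneous $K$-basis) of the socle, listed with multiplicity. A subset $J\subseteq E_G$ is a parity join if $|J\cap C|\le |C|/2$ (equivalently $|J\triangle C|\ge |J|$) for every Eulerian $C\subseteq E_G$ of even cardinality. Given an ordering $E_G=\{e_1,\dots,e_s\}$ of the edges, a parity join $J$ is reduced if, whenever $C\subseteq E_G$ is a non-empty, even cardinality Eulerian subset with $|J\cap C|=|C|/2$, then $J$ contains the last edge of $C$ (that of largest index). For $T\subseteq V_G$, a subset $J\subseteq E_G$ is a $T$-join if $T=\{v\in V_G : \deg_J(v)\text{ is odd}\}$. For $p\in\mathbb{Z}_2=\mathbb{Z}/2\mathbb{Z}$, a $(T,p)$-join is a $T$-join $J$ with $|J|+2\mathbb{Z}=p$. $\mathcal{T}_{\mathrm{p},G}$ is the set of pairs $(T,p)$, $T\subseteq V_G$, $p\in\mathbb{Z}_2$, admitting a $(T,p)$-join; for such a pair, $\tau(T,p)$ is the minimum cardinality of a $(T,p)$-join. For $e\in E_G$ and $(T,p)\in\mathcal{T}_{\mathrm{p},G}$ one has $(T\triangle e,p+1)\in\mathcal{T}_{\mathrm{p},G}$ (where $e$ is regarded as a subset of $V_G$). A pair $(T,p)\in\mathcal{T}_{\mathrm{p},G}$ is a socle pair of $G$ if $\tau(T\triangle e,p+1)=\tau(T,p)-1$ for every $e\in E_G$. *)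

(* Defs.v *)
From HB Require Import structures.
From mathcomp Require Import all_boot all_order all_algebra.
From mathcomp Require Import ring_quotient.
From mathcomp Require Import boolp.
From mathcomp Require Import mpoly.

Set Implicit Arguments.
Unset Strict Implicit.
Unset Printing Implicit Defensive.

Import GRing.Theory.
Local Open Scope ring_scope.

Record simple_graph := SimpleGraph {
  vertex : finType;
  edge_set : {set {set vertex}};
  edge_set_card2 : forall e, e \in edge_set -> #|e| = 2%N
}.

Definition edge (G : simple_graph) := {e : {set vertex G} | e \in edge_set G}.
HB.instance Definition _ (G : simple_graph) := Finite.on (edge G).

Definition symdiff (T : finType) (A B : {set T}) : {set T} :=
  (A :\: B) :|: (B :\: A).

Section Joins.
Variable G : simple_graph.
Implicit Types (C J : {set edge G}) (T : {set vertex G}) (v : vertex G).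

Definition deg C v : nat := #|[set e in C | v \in val e]|.

Definition eulerian C : bool := [forall v, ~~ odd (deg C v)].

Definition parity_join J : bool :=
  [forall C, eulerian C && ~~ odd #|C| ==> (#|J :&: C|.*2 <= #|C|)%N].

Definition edge_ordering (s : seq (edge G)) : bool :=
  perm_eq s (enum {: edge G}).

Definition is_last_edge (s : seq (edge G)) C (e : edge G) : bool :=
  (e \in C) && [forall f in C, (index f s <= index e s)%N].

Definition reduced_parity_join (s : seq (edge G)) J : bool :=
  parity_join J &&
  [forall C, [&& C != set0, ~~ odd #|C|, eulerian C
                & #|J :&: C|.*2 == #|C|]
             ==> [exists e in J, is_last_edge s C e]].

Definition Tjoin T J : bool := T == [set v | odd (deg J v)].

Definition Tpjoin (Tp : {set vertex G} * 'Z_2) J : bool :=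
  Tjoin Tp.1 J && (#|J|%:R == Tp.2).

Definition admits_join (Tp : {set vertex G} * 'Z_2) : bool :=
  [exists J, Tpjoin Tp J].

(* The initial value #|edge G| bounds the size of every join, so this is the
   minimum whenever [admits_join Tp] holds; otherwise the value is junk. *)
Definition tau (Tp : {set vertex G} * 'Z_2) : nat :=
  \big[minn/#|{: edge G}|]_(J | Tpjoin Tp J) #|J|.

(* The condition tau (T + e, p + 1) = tau (T, p) - 1 is written without the
   truncated subtraction of nat. *)
Definition socle_pair (Tp : {set vertex G} * 'Z_2) : bool :=
  admits_join Tp &&
  [forall e : edge G, (tau (symdiff Tp.1 (val e), Tp.2 + 1)).+1 == tau Tp].

End Joins.

Definition ideal_gen (R : comNzRingType) (S : R -> Prop) (x : R) : Prop :=
  exists2 s : seq (R * R), (forall c, c \in s -> S c.2)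
                         & x = \sum_(c <- s) c.1 * c.2.

Section Algebra.
Variables (K : fieldType) (G : simple_graph).

Local Notation edge_ring := {mpoly K[#|{: edge G}|]}.

Definition t_ (e : edge G) : edge_ring := 'X_(enum_rank e).

Definition tset (J : {set edge G}) : edge_ring := \prod_(e in J) t_ e.

Definition eulerian_binomial (f : edge_ring) : Prop :=
  exists J L : {set edge G},
    [/\ J != set0, L != set0, [disjoint J & L], #|J| = #|L|
      & eulerian (J :|: L)] /\ f = tset J - tset L.

Definition eulerian_generator (f : edge_ring) : Prop :=
  eulerian_binomial f \/ exists e, f = t_ e ^+ 2.

Definition eulerian_ideal : {pred edge_ring} :=
  [pred f | `[< ideal_gen eulerian_generator f >]].

Lemma eulerian_idealP : idealr_closed eulerian_ideal.
Proof.
have t0 e : (t_ e).@[fun=> 0] = 0 by rewrite /t_ mevalXU.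
have tset0 (J : {set edge G}) : J != set0 -> (tset J).@[fun=> 0] = 0.
  case/set0Pn => e eJ; rewrite /tset (bigD1 e) //= mevalM.
  by rewrite t0 mul0r.
have gen0 f : eulerian_generator f -> f.@[fun=> 0] = 0.
  case=> [[J [L [[J0 L0 _ _ _] ->]]]|[e ->]].
    by rewrite mevalB !tset0 // subr0.
  by rewrite expr2 mevalM t0 mul0r.
split.
- by apply/asboolP; exists [::]; rewrite ?big_nil.
- apply/negP => /asboolP[s sP] /(congr1 (meval (fun=> 0))) /eqP.
  rewrite meval1 raddf_sum big_seq big1 ?oner_eq0 // => c cs.
  by rewrite /= mevalM (gen0 _ (sP _ cs)) mulr0.
- move=> a u v /asboolP[s sP ->] /asboolP[s' s'P ->]; apply/asboolP.
  exists ([seq (a * c.1, c.2) | c <- s] ++ s').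
    move=> c; rewrite mem_cat => /orP[/mapP[d ds ->]|/s'P//].
    exact: (sP d ds).
  rewrite big_cat big_map mulr_sumr /=; congr (_ + _).
  by apply: eq_bigr => c _; rewrite mulrA.
Qed.
HB.instance Definition _ := isIdealr.Build edge_ring eulerian_ideal eulerian_idealP.

Local Notation eulerian_algebra := {ideal_quot eulerian_ideal}.

Definition to_algebra (f : edge_ring) : eulerian_algebra :=
  (\pi_(eulerian_algebra) f)%qT.

Definition homogeneous (d : nat) (u : eulerian_algebra) : Prop :=
  exists2 f : edge_ring, f \is d.-homog & u = to_algebra f.

Definition irrelevant_ideal : edge_ring -> Prop :=
  ideal_gen (fun f => exists e, f = t_ e).

Definition socle (u : eulerian_algebra) : Prop :=
  forall f, irrelevant_ideal f -> to_algebra f * u = 0.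

Definition generates (us : seq eulerian_algebra)
    (M : eulerian_algebra -> Prop) : Prop :=
  forall u, M u <-> exists c : nat -> edge_ring,
    u = \sum_(i < size us) to_algebra (c i) * us`_i.

Definition minimal_generating (us : seq eulerian_algebra)
    (M : eulerian_algebra -> Prop) : Prop :=
  generates us M /\ forall vs, subseq vs us -> generates vs M -> vs = us.

(* Relational, since a minimal homogeneous generating set is not unique:
   [ds] lists the degrees of some such set, with multiplicity. *)
Definition socle_degrees (ds : seq nat) : Prop :=
  exists us : seq eulerian_algebra,
    [/\ minimal_generating us socle, size ds = size us
      & forall i, (i < size us)%N -> homogeneous (nth 0%N ds i) us`_i].

End Algebra.
Arguments eulerian_ideal : clear implicits.

(* Main.v *)
(** A class is a pair (T, p); two joins have the same class exactly when they
    differ by an even Eulerian set, and parity joins are the smallest of their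
    class.  Modulo I(G), a monomial t_J vanishes when J is not a parity join,
    and two parity joins of one class give the same monomial.  Summing
    the coefficients of the t_J over the parity joins J of a fixed class defines
    a functional that vanishes on I(G).  So A(G) has a basis indexed by the
    admissible classes (T, p), in degree tau(T, p), and t_e sends the basis
    vector of (T, p) to that of (T + e, p + 1) if tau increases and to 0
    otherwise.  Hence the socle is spanned by the basis vectors of the socle
    pairs.  Finally, every admissible class contains exactly one reduced parity
    join. *)
From HB Require Import structures.
Require Import Defs.
From mathcomp Require Import all_boot all_order all_algebra.
From mathcomp Require Import mpoly.
From mathcomp Require Import ring_quotient boolp zify.

Set Implicit Arguments.
Unset Strict Implicit.
Unset Printing Implicit Defensive.

Import GRing.Theory.
Local Open Scope ring_scope.

(** * Symmetric differences of finite sets and their sizes *)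

Section SymmetricDifference.
Variable T : finType.
Implicit Types A B C : {set T}.

Lemma in_symdiff A B x : (x \in symdiff A B) = (x \in A) (+) (x \in B).
Proof. by rewrite !inE; case: (x \in A); case: (x \in B). Qed.

Lemma symdiffK A B : symdiff A (symdiff A B) = B.
Proof. by apply/setP => x; rewrite !in_symdiff addKb. Qed.

Lemma symdiffKr A B : symdiff (symdiff A B) B = A.
Proof. by apply/setP => x; rewrite !in_symdiff addbK. Qed.

Lemma symdiff_eq0 A B : (symdiff A B == set0) = (A == B).
Proof.
apply/eqP/eqP => [/setP AB | ->]; apply/setP => x.
  by have := AB x; rewrite in_symdiff inE; case: (x \in A); case: (x \in B).
by rewrite in_symdiff addbb inE.
Qed.

Lemma card_symdiff A B :
  (#|symdiff A B| + #|A :&: B|.*2 = #|A| + #|B|)%N.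
Proof.
have dAB : [disjoint A :\: B & B :\: A].
  by rewrite -setI_eq0; apply/eqP/setP => x; rewrite !inE; do 2!case: (x \in _).
rewrite /symdiff cardsU disjoint_setI0 // cards0 subn0.
by rewrite -(cardsID B A) -(cardsID A B) [in #|B :&: A|]setIC; lia.
Qed.

Lemma odd_card_symdiff A B : odd #|symdiff A B| = odd #|A| (+) odd #|B|.
Proof. by rewrite -oddD -card_symdiff oddD odd_double addbF. Qed.

Lemma symdiff_disjoint A B : [disjoint A & B] -> symdiff A B = A :|: B.
Proof. by move=> dAB; rewrite /symdiff !(setDidPl _) // disjoint_sym. Qed.

Lemma symdiff_set1 A x :
  symdiff A [set x] = if x \in A then A :\ x else x |: A.
Proof.
apply/setP => y; rewrite in_symdiff; case: ifP => xA; rewrite !inE.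
  by case: eqVneq => [->|]; rewrite ?xA ?addbF.
by case: eqVneq => [->|]; rewrite ?xA ?addbF.
Qed.

End SymmetricDifference.

Lemma natr_Z2_eq m n : (m%:R == n%:R :> 'Z_2) = (odd m == odd n).
Proof.
rewrite -(Zp_nat_mod (isT : (1 < 2)%N) m) -(Zp_nat_mod (isT : (1 < 2)%N) n).
by rewrite !modn2; case: (odd m); case: (odd n).
Qed.

(** * Classes of joins, the minimum [tau], and parity joins *)

Section Joins.
Variable G : simple_graph.
Implicit Types (C J L : {set edge G}) (q : {set vertex G} * 'Z_2) (e : edge G).

Definition jclass J : {set vertex G} * 'Z_2 :=
  ([set v | odd (deg J v)], #|J|%:R).

Definition flip q e : {set vertex G} * 'Z_2 := (symdiff q.1 (val e), q.2 + 1).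

Lemma TpjoinE q J : Tpjoin q J = (jclass J == q).
Proof. by case: q => T p; rewrite /Tpjoin /Tjoin eq_sym. Qed.

Lemma odd_deg_symdiff J L v :
  odd (deg (symdiff J L) v) = odd (deg J v) (+) odd (deg L v).
Proof.
rewrite -odd_card_symdiff; congr (odd #|pred_of_set _|).
apply/setP => e; rewrite inE !in_symdiff 2!inE.
by case: (v \in val e); rewrite ?andbT ?andbF.
Qed.

(** Degree parities and the parity of the size are both additive under symmetric difference. *)
Lemma eq_jclass J L : (jclass J == jclass L) =
  eulerian (symdiff J L) && ~~ odd #|symdiff J L|.
Proof.
rewrite /jclass xpair_eqE natr_Z2_eq odd_card_symdiff.
congr andb; last by do 2!case: (odd _).
apply/eqP/forallP => [/setP JL v | JL].
  by have := JL v; rewrite odd_deg_symdiff !inE => ->; rewrite addbb.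
apply/setP => v; have := JL v.
by rewrite odd_deg_symdiff !inE; do 2!case: (odd _).
Qed.

Lemma jclass_symdiff J C :
  eulerian C -> ~~ odd #|C| -> jclass (symdiff J C) = jclass J.
Proof. by move=> eC oC; apply/eqP; rewrite eq_sym eq_jclass symdiffK eC. Qed.

Lemma jclass_symdiff1 J e : jclass (symdiff J [set e]) = flip (jclass J) e.
Proof.
have d1 v : odd (deg [set e] v) = (v \in val e).
  rewrite /deg; case: (boolP (v \in val e)) => ve.
    rewrite (_ : [set f in [set e] | v \in val f] = [set e]) ?cards1 //.
    by apply/setP => f; rewrite !inE; case: eqVneq => // ->.
  rewrite (_ : [set f in [set e] | v \in val f] = set0) ?cards0 //.
  by apply/setP => f; rewrite !inE; case: eqVneq => // ->; rewrite (negPf ve).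
congr pair.
  by apply/setP => v; rewrite in_symdiff !inE odd_deg_symdiff d1.
apply/eqP; rewrite -(natrD _ _ 1) natr_Z2_eq odd_card_symdiff cards1 oddD.
by [].
Qed.

Lemma flipK q e : flip (flip q e) e = q.
Proof.
case: q => T p; rewrite /flip /= symdiffKr -addrA.
by congr pair; rewrite -[RHS]addr0; congr (_ + _); apply/eqP.
Qed.

Lemma tau_le J q : jclass J = q -> (tau q <= #|J|)%N.
Proof.
move=> Jq; have: Tpjoin q J by rewrite TpjoinE Jq.
rewrite /tau -minEnat => qJ; exact: (@Order.TotalTheory.bigmin_le_cond _ nat).
Qed.

Lemma tau_attained q : admits_join q -> exists2 J, jclass J = q & #|J| = tau q.
Proof.
case/existsP => J0; rewrite TpjoinE => /eqP J0q.
have: tau q = #|{: edge G}| \/ exists2 J, jclass J = q & #|J| = tau q.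
  apply: (big_ind (fun m => m = _ \/ exists2 J, jclass J = q & #|J| = m)).
  - by left.
  - by move=> m n mP nP; rewrite /minn; case: ifP.
  - by move=> J; rewrite TpjoinE => /eqP Jq; right; exists J.
(* If the minimum is the default value, the size of [J0] is squeezed between [tau q] and the number
   of all edges, so [J0] itself attains it. *)
case=> // tauE; exists J0 => //; apply/eqP.
by rewrite eqn_leq tau_le // tauE max_card.
Qed.

Lemma admits_jclass J : admits_join (jclass J).
Proof. by apply/existsP; exists J; rewrite TpjoinE. Qed.

(** As C runs over the even Eulerian sets, [symdiff J C] runs over all joins of the class of J;
    [card_symdiff] then turns the half-size condition into minimality. *)
Lemma parity_joinP J :
  reflect (forall L, jclass L = jclass J -> (#|J| <= #|L|)%N) (parity_join J).
Proof.
apply: (iffP forallP) => [pJ L /eqP | pJ C].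
  rewrite eq_sym eq_jclass => JL; have := implyP (pJ _) JL.
  by have := card_symdiff J (symdiff J L); rewrite symdiffK; lia.
apply/implyP => /andP[eC oC]; have := pJ _ (jclass_symdiff J eC oC).
by have := card_symdiff J C; lia.
Qed.

Lemma parity_joinE J : parity_join J = (#|J| == tau (jclass J)).
Proof.
apply/parity_joinP/eqP => [pJ | -> L /tau_le //].
have [L cL cardL] := tau_attained (admits_jclass J).
by apply/eqP; rewrite eqn_leq tau_le // -cardL pJ.
Qed.

Lemma parity_join_attained q :
  admits_join q -> exists J, parity_join J /\ jclass J = q.
Proof.
by case/tau_attained => J Jq Jt; exists J; rewrite parity_joinE Jq Jt.
Qed.

Lemma sub_parity_join J L : J \subset L -> parity_join L -> parity_join J.
Proof.
move=> JL /forallP pL; apply/forallP => C; apply/implyP => /(implyP (pL C)).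
by apply: leq_trans; rewrite leq_double subset_leq_card ?setSI.
Qed.

Lemma admits_flip q e : admits_join (flip q e) = admits_join q.
Proof.
have adm r : admits_join r -> admits_join (flip r e).
  case/tau_attained => J <- _; rewrite -jclass_symdiff1; exact: admits_jclass.
by apply/idP/idP => /adm //; rewrite flipK.
Qed.

Lemma tau_flip_le q e : admits_join q -> (tau (flip q e) <= (tau q).+1)%N.
Proof.
case/tau_attained => J <- <-; apply: (@leq_trans #|symdiff J [set e]|).
  by apply: tau_le; rewrite jclass_symdiff1.
by have := card_symdiff J [set e]; rewrite cards1; lia.
Qed.

Lemma odd_tau_flip q e : admits_join q -> odd (tau (flip q e)) = ~~ odd (tau q).
Proof.
move=> adq; have adf : admits_join (flip q e) by rewrite admits_flip.
have [J Jq <-] := tau_attained adq; have [L Lq <-] := tau_attained adf.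
move: Lq; rewrite -Jq -jclass_symdiff1 => -[_ /eqP].
by rewrite natr_Z2_eq odd_card_symdiff cards1 addbT => /eqP.
Qed.

(* The parity component of the class rules out [tau (flip q e) = tau q]. *)
Lemma tau_flip q e : admits_join q ->
  tau (flip q e) = (tau q).+1 \/ (tau (flip q e)).+1 = tau q.
Proof.
move=> adq; have adf : admits_join (flip q e) by rewrite admits_flip.
have := tau_flip_le e adq; have := tau_flip_le e adf.
by have := odd_tau_flip e adq; rewrite flipK; lia.
Qed.

(** By [tau_flip] the only alternative to a decrease is an increase, and increases are what
    multiplication by a variable detects. *)
Lemma socle_pairP q :
  reflect (admits_join q /\ forall e, tau (flip q e) <> (tau q).+1)
          (socle_pair q).
Proof.
apply: (iffP andP) => -[adq sq]; split=> //.
  by move=> e; have /eqP := forallP sq e; rewrite -/(flip q e); lia.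
by apply/forallP => e; apply/eqP; case: (tau_flip e adq) => // /sq.
Qed.

(** * Reduced parity joins as representatives of the admissible classes *)

Section Reduced.
Variable s : seq (edge G).
Hypothesis sE : edge_ordering s.

Let index_inj : injective (index^~ s).
Proof.
have in_s e : e \in s by rewrite (perm_mem sE) mem_enum.
by move=> e f ef; rewrite -(nth_index e (in_s e)) ef nth_index.
Qed.

Lemma last_edge C : C != set0 -> exists e, is_last_edge s C e.
Proof.
case/set0Pn => e0 e0C.
case: (@arg_maxnP _ e0 (fun f => f \in C) (index^~ s) e0C) => e eC emax.
by exists e; rewrite /is_last_edge eC; apply/forall_inP => f /emax.
Qed.

Lemma last_edge_uniq C e f : is_last_edge s C e -> is_last_edge s C f -> e = f.
Proof.
move=> /andP[eC /forall_inP he] /andP[fC /forall_inP hf].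
apply: index_inj; apply/eqP; rewrite eqn_leq; apply/andP; split.
  exact: hf.
exact: he.
Qed.

(** Binary encoding of J along the ordering: the last edge on which two sets differ decides which
    one is heavier. *)
Definition weight J := (\sum_(f in J) 2 ^ index f s)%N.

(** Distinct edges have distinct indices, so the powers of two are distinct. Removing the last edge
    e leaves, by induction, less than [2 ^ index e s]. *)
Lemma weight_lt J k :
  (forall f, f \in J -> (index f s < k)%N) -> (weight J < 2 ^ k)%N.
Proof.
move=> Jk.
have [n nE] : exists n, n = #|J| by eexists.
elim: n k J Jk nE => [|n IHn] k J Jk nE.
  have -> : J = set0 by apply/eqP; rewrite -cards_eq0 -nE.
  by rewrite /weight big_set0 expn_gt0.
have [|e] := @last_edge J; first by rewrite -cards_eq0 -nE.
move=> /andP[eJ /forall_inP emax].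
rewrite /weight (big_setD1 e) //= -/(weight (J :\ e)).
have IH : (weight (J :\ e) < 2 ^ index e s)%N.
  apply: IHn; last by move: nE; rewrite (cardsD1 e) eJ => -[].
  move=> f /setD1P[fe fJ]; rewrite ltn_neqAle emax // andbT.
  by apply: contraNneq fe => /index_inj->.
have: (2 ^ (index e s).+1 <= 2 ^ k)%N by rewrite leq_exp2l // Jk.
rewrite expnS => h; apply: leq_trans h.
by rewrite mul2n -addnn ltn_add2l; apply: IH.
Qed.

(* Exchanging along an even Eulerian set C that violates reducedness brings its
   last edge into the join, which increases the weight 2^(i_1) + ... + 2^(i_k);
   hence a join of maximal weight is reduced. *)
Lemma reduced_parity_join_exists q :
  admits_join q -> exists2 J, reduced_parity_join s J & jclass J = q.
Proof.
case/parity_join_attained => J0 [pJ0 cJ0].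
have P0 : parity_join J0 && (jclass J0 == q) by rewrite pJ0 cJ0 eqxx.
case: (@arg_maxnP _ J0 (fun J => parity_join J && (jclass J == q)) weight P0).
move=> J /andP[pJ /eqP cJ] Jmax; exists J => //.
rewrite /reduced_parity_join pJ; apply/forall_inP => C.
case/and4P => C0 oC eC /eqP JC.
have [e eC_last] := last_edge C0; apply/exists_inP; exists e => //.
apply: contraT => eJ; case/andP: eC_last => eC' /forall_inP emax.
have cS := jclass_symdiff J eC oC; have cardS := card_symdiff J C.
have /Jmax : parity_join (symdiff J C) && (jclass (symdiff J C) == q).
  by move: pJ; rewrite !parity_joinE cS cJ eqxx andbT; lia.
(* Both joins agree outside C, so only their parts inside C have to be compared. *)
have wJ : weight J = (weight (J :&: C) + weight (J :\: C))%N.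
  by rewrite /weight (big_setID C).
have wS : weight (symdiff J C) = (weight (C :\: J) + weight (J :\: C))%N.
  have SI : symdiff J C :&: C = C :\: J.
    by apply/setP => f; rewrite inE in_symdiff !inE; do 2!case: (_ \in _).
  have SD : symdiff J C :\: C = J :\: C.
    by apply/setP => f; rewrite inE in_symdiff !inE; do 2!case: (_ \in _).
  by rewrite -SI -SD /weight (big_setID C).
have : (weight (J :&: C) < 2 ^ index e s)%N.
  apply: weight_lt => f /setIP[fJ fC]; rewrite ltn_neqAle emax // andbT.
  by apply: contraNneq eJ => /index_inj <-.
have : (2 ^ index e s <= weight (C :\: J))%N.
  by rewrite /weight (big_setD1 e) ?leq_addr // inE eJ.
by move=> h1 h2 h3; move: h3 h1 h2; rewrite wJ wS /geq /=; lia.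
Qed.

(** Both sets have the minimal size of their class, so each contains exactly half of C, their
    symmetric difference. If C were non-empty, its last edge would lie in both, which no edge of C
    does. *)
Lemma reduced_parity_join_inj J L : reduced_parity_join s J ->
  reduced_parity_join s L -> jclass J = jclass L -> J = L.
Proof.
move=> /andP[pJ rJ] /andP[pL rL] cJL; apply/eqP; rewrite -symdiff_eq0.
apply: contraT => C0; set C := symdiff J L in C0.
have : eulerian C && ~~ odd #|C| by rewrite -eq_jclass cJL.
case/andP=> eC oC; have JL : #|J| = #|L|.
  by move: pJ pL; rewrite !parity_joinE cJL => /eqP-> /eqP->.
have IJ : J :&: C = J :\: L.
  by apply/setP => f; rewrite inE in_symdiff !inE; do 2!case: (_ \in _).
have IL : L :&: C = L :\: J.
  by apply/setP => f; rewrite inE in_symdiff !inE; do 2!case: (_ \in _).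
have h1 : (#|J :&: C|.*2 == #|C|).
  have := card_symdiff J L; rewrite -/C IJ.
  by have := cardsID L J; lia.
have h2 : (#|L :&: C|.*2 == #|C|).
  have := card_symdiff J L; rewrite -/C IL (setIC J).
  by have := cardsID J L; lia.
have /exists_inP[e eJ eC1] : [exists e in J, is_last_edge s C e].
  by apply: (implyP (forallP rJ C)); rewrite C0 oC eC.
have /exists_inP[f fL fC1] : [exists e in L, is_last_edge s C e].
  by apply: (implyP (forallP rL C)); rewrite C0 oC eC.
have ef := last_edge_uniq eC1 fC1; rewrite -ef in fL.
by case/andP: eC1; rewrite in_symdiff eJ fL.
Qed.

End Reduced.
End Joins.

(** * Square-free monomials modulo the ideal *)

Section Coordinates.
Variables (K : fieldType) (G : simple_graph).
Implicit Types (J L : {set edge G}) (q : {set vertex G} * 'Z_2) (e : edge G).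

Local Notation nE := #|{: edge G}|.
Local Notation edge_ring := {mpoly K[nE]}.
Local Notation I := (eulerian_ideal K G).
Implicit Types f g : edge_ring.

Lemma natrb_neq0 (b : bool) : (b%:R != 0 :> K) = b.
Proof. by case: b; rewrite ?oner_neq0 ?eqxx. Qed.

Definition mset J : 'X_{1..nE} := [multinom (enum_val i \in J : nat) | i < nE].

Lemma msetE J e : mset J (enum_rank e) = (e \in J).
Proof. by rewrite mnmE enum_rankK. Qed.

Lemma mset_inj : injective mset.
Proof.
move=> J L JL; apply/setP => e.
by have := msetE J e; rewrite JL msetE; do 2!case: (_ \in _).
Qed.

Lemma mdeg_mset J : mdeg (mset J) = #|J|.
Proof.
rewrite mdegE (reindex (@enum_rank (edge G))) /=; last first.
  exact: onW_bij (enum_rank_bij _).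
rewrite -[RHS]sum1_card [RHS]big_mkcond; apply: eq_bigr => e _.
by rewrite msetE; case: ifP.
Qed.

Lemma tsetE J : tset K J = 'X_[mset J].
Proof.
rewrite mpolyXE_id (reindex (@enum_rank (edge G))) /=; last first.
  exact: onW_bij (enum_rank_bij _).
rewrite /tset big_mkcond; apply: eq_bigr => e _; rewrite msetE.
by case: ifP; rewrite ?expr1 ?expr0.
Qed.

Lemma tset_setU1 J e : e \notin J -> tset K (e |: J) = tset K J * t_ K e.
Proof. by move=> eJ; rewrite /tset big_setU1 //= mulrC. Qed.

Lemma tset_setID J L : tset K J = tset K (J :&: L) * tset K (J :\: L).
Proof. by rewrite /tset (big_setID L). Qed.

Lemma gen_in_ideal f : eulerian_generator f -> f \in I.
Proof.
move=> gf; apply/asboolP; exists [:: (1, f)]; last by rewrite big_seq1 mul1r.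
by move=> c; rewrite inE => /eqP ->.
Qed.

Lemma tset_mul_t_mem J e : e \in J -> tset K J * t_ K e \in I.
Proof.
move=> eJ; rewrite /tset (big_setD1 e) //= mulrAC mulrC.
by apply: idealMr; apply: gen_in_ideal; right; exists e; rewrite expr2.
Qed.

(** Factoring out the monomial of [J :&: L] leaves the Eulerian binomial of the two set differences,
    which have equal size. *)
Lemma tset_sub_mem J L :
  jclass J = jclass L -> #|J| = #|L| -> tset K J - tset K L \in I.
Proof.
move=> cJL cardJL; have [->|JL] := eqVneq J L; first by rewrite subrr rpred0.
rewrite (tset_setID J L) (tset_setID L J) (setIC L) -mulrBr.
apply: idealMr; apply: gen_in_ideal; left.
have cD : #|J :\: L| = #|L :\: J|.
  by have := cardsID L J; have := cardsID J L; rewrite (setIC L); lia.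
have symE : symdiff J L != set0 by rewrite symdiff_eq0.
exists (J :\: L), (L :\: J); split=> //; split=> //.
- apply: contraNneq symE => JL0; rewrite /symdiff JL0 set0U -cards_eq0 -cD JL0.
  by rewrite cards0.
- apply: contraNneq symE => JL0; rewrite /symdiff JL0 setU0 -cards_eq0 cD JL0.
  by rewrite cards0.
- by rewrite -setI_eq0; apply/eqP/setP => x; rewrite !inE; do 2!case: (x \in _).
- by have := eq_jclass J L; rewrite cJL eqxx => /esym/andP[].
Qed.

(* If J meets an even Eulerian C in more than half of C, replace half of C
   inside J by the other half: the new monomial has a repeated variable. *)
Lemma tset_mem J : ~~ parity_join J -> tset K J \in I.
Proof.
case/forallPn => C; rewrite negb_imply -ltnNge => /andP[/andP[eC oC] JC].
have [A subA cardA] :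
    exists2 A : {set edge G}, A \subset J :&: C & #|A|.*2 = #|C|.
  have : (#|C|./2 <= #|J :&: C|)%N by lia.
  case/card_geqP => r [ur sr rJC]; exists [set x in r].
    by apply/subsetP => x; rewrite inE => /rJC.
  by rewrite cardsE (card_uniqP ur) sr; lia.
(* The excess over half of C provides an edge in both [J :\: A] and [C :\: A]; its variable becomes
   a square once A is replaced by [C :\: A]. *)
have [e eJC eA] : exists2 e, e \in J :&: C & e \notin A.
  by apply/subsetPn/negP => /subset_leq_card; lia.
have subAC : A \subset C := subset_trans subA (subsetIr _ _).
have subAJ : A \subset J := subset_trans subA (subsetIl _ _).
have ACA : symdiff A C = C :\: A.
  apply/setP => x; rewrite in_symdiff inE.
  by case: (boolP (x \in A)) => [/(subsetP subAC)->|].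
have AB : tset K A - tset K (C :\: A) \in I.
  apply: tset_sub_mem; first by rewrite -ACA jclass_symdiff.
  by have := cardsID A C; rewrite (setIidPr subAC); lia.
rewrite (tset_setID J A) (setIidPr subAJ).
rewrite -(subrK (tset K (C :\: A)) (tset K A)) mulrDl.
rewrite rpredD //; first by rewrite mulrC idealMr.
case/setIP: eJC => eJ eCm; rewrite [tset K (J :\: A)]/tset (big_setD1 e) /=.
  by rewrite mulrA mulrC idealMr // tset_mul_t_mem // inE eA.
by rewrite inE eA.
Qed.

(** * Coordinate functionals, normal forms and membership in the ideal *)

Definition class_coord q f : K :=
  \sum_(J | parity_join J && (jclass J == q)) f@_(mset J).

Fact coord_linear q : scalar (class_coord q).
Proof.
move=> a f g; rewrite /class_coord mulr_sumr -big_split /=.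
by apply: eq_bigr => J _; rewrite mcoeffD mcoeffZ.
Qed.
HB.instance Definition _ q :=
  GRing.isLinear.Build K edge_ring K _ (class_coord q) (coord_linear q).

Lemma coordX_mset q J :
  class_coord q 'X_[mset J] = (parity_join J && (jclass J == q))%:R.
Proof.
rewrite /class_coord; under eq_bigr => L _ do rewrite mcoeffX (inj_eq mset_inj).
case: (boolP (_ && _)) => PJ.
  rewrite (bigD1 J) //= eqxx big1 ?addr0 // => L /andP[_ LJ].
  by rewrite eq_sym (negPf LJ).
by rewrite big1 // => L PL; case: eqVneq => // JL; rewrite -JL (negPf PJ) in PL.
Qed.

Lemma coordX_eq0 q m : (forall J, m != mset J) -> class_coord q 'X_[m] = 0.
Proof. by move=> mJ; apply: big1 => J _; rewrite mcoeffX (negPf (mJ J)). Qed.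

Lemma coord_neq0 q f :
  class_coord q f != 0 ->
  exists J, [/\ parity_join J, jclass J = q & f@_(mset J) != 0].
Proof.
move=> h; have /existsP[J /andP[/andP[pJ /eqP cJ] fJ]] :
    [exists J, (parity_join J && (jclass J == q)) && (f@_(mset J) != 0)].
  apply: contraT; rewrite negb_exists => /forallP hJ; case/eqP: h.
  apply: big1 => J PJ; have := hJ J; rewrite PJ /=; by move/negPn/eqP.
by exists J.
Qed.

Lemma mset_squarefree (m : 'X_{1..nE}) :
  (forall i, m i <= 1)%N -> m = mset [set e | m (enum_rank e) != 0%N].
Proof.
move=> m1; apply/mnmP => i; rewrite mnmE inE enum_valK.
by have := m1 i; case: (m i) => [|[|]].
Qed.

Lemma mset_setU J L : [disjoint J & L] -> mset (J :|: L) = (mset J + mset L)%MM.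
Proof.
move=> dJL; apply/mnmP => i; rewrite mnmDE !mnmE inE.
by case: (boolP (enum_val i \in J)) => // /(disjointFr dJL)->.
Qed.

Lemma msetD_inv m J L :
  (m + mset J)%MM = mset L -> J \subset L /\ m = mset (L :\: J).
Proof.
move=> mJL; have {}mJL e : (m (enum_rank e) + (e \in J))%N = (e \in L).
  by rewrite -!msetE -mnmDE mJL.
split.
  by apply/subsetP => e eJ; have := mJL e; rewrite eJ; case: (e \in L); lia.
have mE e : m (enum_rank e) = (e \in L :\: J).
  by rewrite inE; move: (mJL e); case: (e \in J); case: (e \in L); lia.
by apply/mnmP => i; rewrite -(enum_valK i) msetE mE.
Qed.

(* With [m] the monomial of M, the symmetric difference of M and L has the class
   of the parity join M + J, so it is at least as large: M and L are disjoint. *)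
Lemma coord_exchange m q J L :
    [disjoint J & L] -> jclass J = jclass L -> #|J| = #|L| ->
  class_coord q 'X_[m + mset J] != 0 -> class_coord q 'X_[m + mset L] = 1.
Proof.
move=> dJL cJL cardJL /coord_neq0[N [pN cN]].
rewrite mcoeffX natrb_neq0 => /eqP /msetD_inv[JN ->].
set M := N :\: J; have dMJ : [disjoint M & J].
  rewrite /M -setI_eq0; apply/eqP/setP => x; rewrite !inE.
  by case: (x \in J); rewrite ?andbF.
have NE : symdiff M J = N.
  by apply/setP => x; rewrite /M in_symdiff !inE;
    case: (boolP (x \in J)) => [/(subsetP JN)->|]; rewrite ?addbF.
have : eulerian (symdiff J L) && ~~ odd #|symdiff J L|.
  by rewrite -eq_jclass cJL.
case/andP=> eC oC.
have cML : jclass (symdiff M L) = q.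
  rewrite -cN -(jclass_symdiff N eC oC) -NE; congr jclass; apply/setP => x.
  by rewrite !in_symdiff; do 3!case: (x \in _).
have cardML := card_symdiff M L.
have cardMJ : #|N| = (#|M| + #|J|)%N.
  by have := card_symdiff M J; rewrite NE disjoint_setI0 // cards0; lia.
have dML : [disjoint M & L].
  rewrite -setI_eq0 -cards_eq0; have /parity_joinP := pN.
  by move=> /(_ (symdiff M L)); rewrite cML cN => /(_ erefl); lia.
rewrite -mset_setU // coordX_mset -symdiff_disjoint // cML eqxx andbT.
rewrite parity_joinE cML; move: pN; rewrite parity_joinE cN => /eqP <-.
suff -> : #|symdiff M L| = #|N| by rewrite eqxx.
by move: cardML; rewrite disjoint_setI0 // cards0; lia.
Qed.

Lemma coordX01 q m : class_coord q 'X_[m] = 0 \/ class_coord q 'X_[m] = 1.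
Proof.
have [->|/coord_neq0[J [pJ cJ]]] := eqVneq (class_coord q 'X_[m]) 0.
  by left.
rewrite mcoeffX natrb_neq0 => /eqP ->; right.
by rewrite coordX_mset pJ cJ eqxx.
Qed.

(** Such products span the ideal over K. A multiple of [t_ K e ^+ 2] is not square-free and has no
    coordinate; binomials are handled by [coord_exchange]. *)
Lemma class_coord_mulX_gen q m g :
  eulerian_generator g -> class_coord q ('X_[m] * g) = 0.
Proof.
case=> [[J [L [[J0 L0 dJL cardJL eJL] ->]]]|[e ->]]; last first.
  rewrite /t_ expr2 -!mpolyXD coordX_eq0 // => J; apply/eqP.
  move/(congr1 (fun m0 : 'X_{1..nE} => m0 (enum_rank e))).
  rewrite msetE !mnmDE mnm1E eqxx.
  by case: (e \in J); lia.
have cJL : jclass J = jclass L.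
  apply/eqP; rewrite eq_jclass symdiff_disjoint // eJL.
  by rewrite -symdiff_disjoint // odd_card_symdiff cardJL addbb.
rewrite !tsetE mulrBr -!mpolyXD linearB /=.
have dLJ : [disjoint L & J] by rewrite disjoint_sym.
have hJ := @coord_exchange m q J L dJL cJL cardJL.
have hL := @coord_exchange m q L J dLJ (esym cJL) (esym cardJL).
(* Both coordinates are 0 or 1, and the exchange in either direction excludes that they differ. *)
case: (coordX01 q (m + mset J)%MM) => h1;
  case: (coordX01 q (m + mset L)%MM) => h2.
- by rewrite h1 h2 subrr.
- by move: (h1); rewrite hL ?h2 ?oner_neq0 // => ->; rewrite subrr.
- by move: (h2); rewrite hJ ?h1 ?oner_neq0 // => ->; rewrite subrr.
- by rewrite h1 h2 subrr.
Qed.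

Lemma coord_ideal q f : f \in I -> class_coord q f = 0.
Proof.
case/asboolP => r rP ->; rewrite linear_sum big_seq big1 //= => c /rP cgen.
rewrite [c.1]mpolyE mulr_suml linear_sum big1 //= => m _.
by rewrite -scalerAl linearZ /= class_coord_mulX_gen // mulr0.
Qed.

(* [set0] is a junk value for a class without joins. *)
Definition min_join q : {set edge G} :=
  odflt set0 [pick J | parity_join J && (jclass J == q)].

Lemma min_joinP q :
  admits_join q -> parity_join (min_join q) /\ jclass (min_join q) = q.
Proof.
move=> adq; rewrite /min_join; case: pickP => [J /andP[pJ /eqP cJ] //|h].
have [J [pJ cJ]] := parity_join_attained adq.
by move: (h J); rewrite pJ cJ eqxx.
Qed.

(** A class without joins has an empty sum as coordinate, so the junk value of [min_join] never
    contributes. *)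
Definition normal_form f : edge_ring :=
  \sum_q class_coord q f *: tset K (min_join q).

Fact normal_form_linear : linear normal_form.
Proof.
move=> a f g; rewrite /normal_form scaler_sumr -big_split /=.
by apply: eq_bigr => q _; rewrite linearP scalerDl scalerA.
Qed.
HB.instance Definition _ :=
  GRing.isLinear.Build K edge_ring edge_ring _ normal_form normal_form_linear.

Lemma ideal_scale a f : f \in I -> a *: f \in I.
Proof. by rewrite -mul_mpolyC; apply: idealMr. Qed.

(** By linearity f is a monomial. If it is not square-free, or its edge set is not a parity join, it
    lies in the ideal and its normal form is 0. Otherwise it is congruent to the chosen minimal
    monomial of its class by [tset_sub_mem]. *)
Lemma sub_normal_form_mem f : f - normal_form f \in I.
Proof.
rewrite {1 2}[f]mpolyE [normal_form _]linear_sum -sumrB rpred_sum //= => m _.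
rewrite linearZ /= -scalerBr ideal_scale //.
have [m1|] := boolP [forall i, m i <= 1]%N; last first.
  case/forallPn => i; rewrite -ltnNge => mi.
  rewrite /normal_form big1 => [|q _]; last first.
    rewrite coordX_eq0 ?scale0r // => J; apply: contraTneq mi => ->.
    by rewrite mnmE; case: (_ \in _).
  have -> : m = (U_(i) *+ 2 + (m - U_(i) *+ 2))%MM.
    apply/mnmP => j; rewrite mnmDE mnmBE mulmnE mnm1E.
    by case: eqVneq => [<-|]; lia.
  rewrite subr0 mpolyXD mulrC idealMr // gen_in_ideal //; right.
  by exists (enum_val i); rewrite /t_ enum_valK mpolyXn.
rewrite (mset_squarefree (fun i => forallP m1 i)); set J := finset _.
have [pJ|nJ] := boolP (parity_join J); last first.
  rewrite /normal_form big1 ?subr0 -?tsetE ?tset_mem // => q _.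
  by rewrite tsetE coordX_mset (negPf nJ) scale0r.
have [pq cq] := min_joinP (admits_jclass J).
rewrite /normal_form (bigD1 (jclass J)) //= big1 => [|q qJ]; last first.
  by rewrite coordX_mset eq_sym (negPf qJ) andbF scale0r.
rewrite coordX_mset pJ eqxx scale1r addr0 -tsetE tset_sub_mem //.
by move: pJ pq; rewrite !parity_joinE cq => /eqP -> /eqP ->.
Qed.

(** The functionals kill the ideal; conversely f is congruent to its normal form, whose coefficients
    are these coordinates. *)
Lemma mem_idealP f : reflect (forall q, class_coord q f = 0) (f \in I).
Proof.
apply: (iffP idP) => [fI q|f0]; first exact: coord_ideal.
rewrite -(subrK (normal_form f) f) rpredD ?sub_normal_form_mem //.
by rewrite /normal_form big1 ?rpred0 // => q _; rewrite f0 scale0r.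
Qed.

(** * Multiplication by a variable in coordinates *)

Lemma mset1 e : mset [set e] = U_(enum_rank e)%MM.
Proof.
apply/mnmP => i; rewrite mnmE mnm1E inE -[i]enum_valK.
by rewrite (inj_eq enum_rank_inj) enum_valK eq_sym.
Qed.

(** Deleting e from a parity join of class [flip q e] gives a join of class q; this forces [tau] to
    increase along e and makes the smaller join minimal. Conversely, when [tau] increases, no parity
    join of class q contains e, and adding e preserves minimality. *)
Lemma coordX_mul_t q e m : class_coord (flip q e) ('X_[m] * t_ K e) =
  (tau (flip q e) == (tau q).+1)%:R * class_coord q 'X_[m].
Proof.
rewrite /t_ -mset1 -mpolyXD; set up := _ == _.
have fwd : class_coord (flip q e) 'X_[m + mset [set e]] != 0 ->
    up /\ class_coord q 'X_[m] = 1.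
  case/coord_neq0 => N [pN cN].
  rewrite mcoeffX natrb_neq0 => /eqP /msetD_inv[].
  rewrite sub1set => eN ->.
  have NE : symdiff N [set e] = N :\ e by rewrite symdiff_set1 eN.
  have cNe : jclass (N :\ e) = q by rewrite -NE jclass_symdiff1 cN flipK.
  have adq : admits_join q by rewrite -cNe admits_jclass.
  have tq := tau_le cNe; move: pN; rewrite parity_joinE cN => /eqP cardN.
  have cardNe : #|N| = #|N :\ e|.+1 by rewrite (cardsD1 e) eN.
  have upT : tau (flip q e) = (tau q).+1.
    by case: (tau_flip e adq) => //; lia.
  rewrite /up upT eqxx; split=> //; rewrite coordX_mset cNe eqxx andbT.
  by rewrite parity_joinE cNe (_ : #|_| = tau q) ?eqxx //; lia.
have bwd : up -> class_coord q 'X_[m] != 0 ->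
    class_coord (flip q e) 'X_[m + mset [set e]] = 1.
  move=> /eqP upT /coord_neq0[J [pJ cJ]].
  rewrite mcoeffX natrb_neq0 => /eqP ->.
  have cJe : jclass (symdiff J [set e]) = flip q e.
    by rewrite jclass_symdiff1 cJ.
  have tJe := tau_le cJe; move: pJ; rewrite parity_joinE cJ => /eqP cardJ.
  have cardJe := card_symdiff J [set e]; rewrite cards1 in cardJe.
  have dJe : [disjoint J & [set e]] by rewrite -setI_eq0 -cards_eq0; lia.
  rewrite -mset_setU // coordX_mset -symdiff_disjoint // cJe eqxx andbT.
  by rewrite parity_joinE cJe (_ : #|_| = tau (flip q e)) ?eqxx //; lia.
have [h0|h1] := eqVneq (class_coord (flip q e) 'X_[m + mset [set e]]) 0.
  rewrite h0; case: (boolP up) => [upT|]; last by rewrite mul0r.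
  have [->|/(bwd upT)] := eqVneq (class_coord q 'X_[m]) 0.
    by rewrite mulr0.
  by rewrite h0 => /esym/eqP; rewrite oner_eq0.
have [upT cm] := fwd h1.
by rewrite bwd // cm ?upT ?mulr1 // oner_neq0.
Qed.

Lemma coord_mul_t q e f : class_coord (flip q e) (f * t_ K e) =
  (tau (flip q e) == (tau q).+1)%:R * class_coord q f.
Proof.
rewrite [f]mpolyE mulr_suml !linear_sum mulr_sumr; apply: eq_bigr => m _.
by rewrite -scalerAl !linearZ /= coordX_mul_t mulrCA.
Qed.

Lemma tset_idealE J : (tset K J \in I) = ~~ parity_join J.
Proof.
apply/idP/idP => [/mem_idealP/(_ (jclass J))|]; last exact: tset_mem.
rewrite tsetE coordX_mset eqxx andbT; case: (parity_join J) => //.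
by move/eqP; rewrite oner_eq0.
Qed.

End Coordinates.

(** * Linear algebra of finite sequences and delta functions *)

Lemma seq_coord_span (K : fieldType) (vT : vectType K) (X : seq vT) v :
  v \in <<X>>%VS -> exists k : nat -> K, v = \sum_(i < size X) k i *: X`_i.
Proof.
move/(@coord_span _ _ _ (in_tuple X)) => ->.
exists (fun i => oapp (fun j => coord (in_tuple X) j v) 0 (insub i)).
by apply: eq_bigr => i _; rewrite valK.
Qed.

(** Recording the selection as a mask allows it to be carried from coordinate vectors back to
    elements of the algebra. *)
Lemma span_free_mask (K : fieldType) (vT : vectType K) (X : seq vT) :
  exists m : bitseq,
    [/\ size m = size X, free (mask m X) & <<mask m X>>%VS = <<X>>%VS].
Proof.
elim: X => [|x X [m [sm fm mX]]]; first by exists [::]; rewrite nil_free.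
have [xX|xX] := boolP (x \in <<X>>%VS).
  exists (false :: m); rewrite /= sm; split=> //.
  by rewrite mX span_cons; apply/esym/addv_idPr; rewrite -memvE.
exists (true :: m); rewrite /= sm; split=> //.
  by rewrite free_cons mX xX.
by rewrite !span_cons mX.
Qed.

Lemma free_mask (K : fieldType) (vT : vectType K) (m : bitseq) (X : seq vT) :
  free X -> free (mask m X).
Proof.
elim: X m => [|x X IHX] [|b m] //=; rewrite ?nil_free //.
rewrite free_cons => /andP[xX fX]; case: b; last exact: IHX.
rewrite free_cons IHX // andbT; apply: contra xX.
by apply/subvP/sub_span => y; apply: mem_mask.
Qed.

(** The position pairs a selected generator with its degree in the parallel list. *)
Lemma mem_mask_nth (T : eqType) (x0 y : T) (m : bitseq) (r : seq T) :
  y \in mask m r ->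
  exists i, [/\ (i < size r)%N, nth false m i & nth x0 r i = y].
Proof.
elim: r m => [|x r IHr] [|b m] //= y_r.
have [y_m|y_m] := boolP (y \in mask m r).
  by have [i [ir mi <-]] := IHr m y_m; exists i.+1.
move: y_r; case: b; last by rewrite (negPf y_m).
by rewrite inE (negPf y_m) orbF => /eqP ->; exists 0%N.
Qed.

Section DeltaFunctions.
Variables (K : fieldType) (Q : finType).
Local Notation V := {ffun Q -> K^o}.
Implicit Types (v : V) (q : Q) (s : seq Q).

Definition delta q : V := [ffun r => (r == q)%:R].

Lemma span_deltaP s v :
  reflect (forall q, v q != 0 -> q \in s) (v \in <<map delta s>>%VS).
Proof.
apply: (iffP idP) => [/seq_coord_span[k ->] q|vs].
  apply: contraR => qs; rewrite sum_ffunE big1 // => i _.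
  have is_ : (i < size s)%N by rewrite -(size_map delta).
  rewrite ffunE (nth_map q) // ffunE.
  case: eqVneq => [qi|]; last by rewrite scaler0.
  by rewrite qi mem_nth in qs.
rewrite [v](_ : _ = \sum_q v q *: delta q); last first.
  apply/ffunP => r; rewrite sum_ffunE (bigD1 r) //= big1 => [|q qr].
    by rewrite !ffunE eqxx addr0 [RHS]mulr1.
  by rewrite !ffunE eq_sym (negPf qr) scaler0.
rewrite memv_suml // => q _; have [->|/vs qs] := eqVneq (v q) 0.
  by rewrite scale0r mem0v.
by rewrite memvZ // memv_span // map_f.
Qed.

Lemma free_delta s : uniq s -> free (map delta s).
Proof.
elim: s => [|q s IHs] /=; first by rewrite nil_free.
case/andP=> qs us; rewrite free_cons IHs // andbT.
apply: contra qs => /span_deltaP/(_ q); apply.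
by rewrite ffunE eqxx oner_neq0.
Qed.

Lemma dim_span_delta s : uniq s -> \dim <<map delta s>> = size s.
Proof. by move/free_delta/eqP ->; rewrite size_map. Qed.

End DeltaFunctions.

(** * The socle of the algebra, its bases and its degrees *)

Section EulerianAlgebra.
Variables (K : fieldType) (G : simple_graph).
Local Notation nE := #|{: edge G}|.
Local Notation edge_ring := {mpoly K[nE]}.
Local Notation I := (eulerian_ideal K G).
Local Notation A := {ideal_quot I}.
Local Notation Q := ({set vertex G} * 'Z_2)%type.
Local Notation V := {ffun Q -> K^o}.
Implicit Types (f g : edge_ring) (u : A) (us : seq A) (q : Q).

Definition coordv f : V := [ffun q => class_coord q f].

Fact coordv_linear : linear coordv.
Proof. by move=> a f g; apply/ffunP => q; rewrite !ffunE linearP. Qed.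
HB.instance Definition _ :=
  GRing.isLinear.Build K edge_ring V _ coordv coordv_linear.

Lemma coordv_eq0 f : (coordv f == 0) = (f \in I).
Proof.
apply/eqP/mem_idealP => [/ffunP f0 q|f0]; first by have := f0 q; rewrite !ffunE.
by apply/ffunP => q; rewrite !ffunE f0.
Qed.

Lemma to_algebra_eq f g :
  (to_algebra f == to_algebra g) = (coordv f == coordv g).
Proof. by rewrite -[RHS]subr_eq0 -linearB coordv_eq0 Quotient.idealrBE. Qed.

Lemma to_algebra_repr u : to_algebra (repr u) = u.
Proof. exact: reprK. Qed.

(** Independent of the representative, additive and injective: spans, bases and dimensions are
    computed on these vectors. *)
Definition acoord u : V := coordv (repr u).

Lemma acoord_to_algebra f : acoord (to_algebra f) = coordv f.
Proof. by apply/eqP; rewrite -to_algebra_eq to_algebra_repr. Qed.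

Lemma acoord_inj : injective acoord.
Proof.
move=> u w /eqP; rewrite -to_algebra_eq !to_algebra_repr.
by move/eqP.
Qed.

Lemma to_algebraM f g : to_algebra (f * g) = to_algebra f * to_algebra g.
Proof. exact: rmorphM. Qed.

Lemma acoord_zmod_morphism : zmod_morphism acoord.
Proof.
move=> u w; rewrite -(to_algebra_repr u) -(to_algebra_repr w).
rewrite -[to_algebra _ - to_algebra _](rmorphB (\pi_A)%qT).
by rewrite !acoord_to_algebra linearB.
Qed.
HB.instance Definition _ :=
  GRing.isZmodMorphism.Build A V acoord acoord_zmod_morphism.

Definition socle_pairs : seq Q := enum [set q | socle_pair q].

Definition socle_space : {vspace V} := <<map (@delta K Q) socle_pairs>>%VS.

Lemma socle_t u : socle u <-> forall e, to_algebra (t_ K e) * u = 0.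
Proof.
split=> [su e|su f [r rP ->]].
  apply: su; exists [:: (1, t_ K e)]; last by rewrite big_seq1 mul1r.
  by move=> c; rewrite inE => /eqP ->; exists e.
rewrite /to_algebra rmorph_sum mulr_suml big_seq big1 // => c /rP[e ->].
by rewrite rmorphM -mulrA [X in _ * X]su mulr0.
Qed.

(** Multiplication by [t_ K e] moves the coordinate at q to [flip q e] if [tau] increases and kills
    it otherwise. So u is annihilated by all variables exactly when its support avoids every q with
    an increase. *)
Lemma socleP u : socle u <-> acoord u \in socle_space.
Proof.
rewrite -(to_algebra_repr u) acoord_to_algebra; set f := repr u.
have tE e : to_algebra (t_ K e) * to_algebra f = 0 <-> coordv (f * t_ K e) = 0.
  rewrite -to_algebraM mulrC -acoord_to_algebra.
  by split=> [->|]; [rewrite raddf0|rewrite -[0](raddf0 acoord) => /acoord_inj].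
rewrite socle_t; split=> [su|/span_deltaP su e].
  apply/span_deltaP => q; rewrite ffunE mem_enum inE => fq; apply/socle_pairP.
  split; first by have [J [_ <- _]] := coord_neq0 fq; exact: admits_jclass.
  move=> e up; have /tE/ffunP/(_ (flip q e)) := su e.
  by rewrite !ffunE coord_mul_t up eqxx mul1r; apply/eqP.
(* Since [flip] is an involution in q, every class r is a flip along e, so [coord_mul_t] describes
   all coordinates of the product. *)
apply/tE/ffunP => r; rewrite !ffunE -(flipK r e) coord_mul_t.
set q := flip r e; have := su q; rewrite ffunE.
have [->|_ /(_ isT)] := eqVneq (class_coord q f) 0; first by rewrite mulr0.
by rewrite mem_enum inE => /socle_pairP[_ /(_ e)/eqP/negPf->]; rewrite mul0r.
Qed.

(** Every monomial other than 1 contains a variable and hence kills u, so only the constant term of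
    f acts. *)
Lemma acoord_mul_socle f u :
  socle u -> acoord (to_algebra f * u) = f@_0%MM *: acoord u.
Proof.
move=> /socle_t su.
rewrite -(to_algebra_repr u) -to_algebraM !acoord_to_algebra.
set g := repr u.
have mono m : coordv ('X_[m] * g) = (m == 0%MM)%:R *: coordv g.
  have [->|] := eqVneq m 0%MM; first by rewrite mpolyX0 mul1r scale1r.
  rewrite scale0r -mdeg_eq0 => m0.
  have [i mi] : exists i, m i != 0%N.
    apply/existsP; apply: contraR m0; rewrite negb_exists mdegE => /forallP m0.
    by rewrite big1 // => i _; apply/eqP/negPn.
  have -> : m = (m - U_(i) + U_(i))%MM by rewrite submK // lep1mP.
  apply/eqP; rewrite mpolyXD coordv_eq0 -mulrA idealMr // -coordv_eq0.
  have := su (enum_val i).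
  rewrite -(to_algebra_repr u) -to_algebraM /t_ enum_valK.
  by move/(congr1 acoord); rewrite acoord_to_algebra raddf0 => ->.
rewrite {1}[f]mpolyE mulr_suml linear_sum /=.
rewrite [in RHS](mpolyE f) raddf_sum scaler_suml; apply: eq_bigr => m _ /=.
by rewrite -scalerAl linearZ /= mono mcoeffZ mcoeffX scalerA.
Qed.

Lemma acoord_comb us (c : nat -> edge_ring) :
  (forall i, (i < size us)%N -> socle us`_i) ->
  acoord (\sum_(i < size us) to_algebra (c i) * us`_i) =
  \sum_(i < size us) (c i)@_0%MM *: (map acoord us)`_i.
Proof.
move=> sus; rewrite raddf_sum; apply: eq_bigr => i _ /=.
by rewrite acoord_mul_socle ?(nth_map (0 : A)) //; apply: sus.
Qed.

Lemma acoord_min_join q :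
  admits_join q -> acoord (to_algebra (tset K (min_join q))) = delta K q.
Proof.
case/min_joinP => pq cq; rewrite acoord_to_algebra; apply/ffunP => r.
by rewrite !ffunE tsetE coordX_mset pq cq eq_sym.
Qed.

Lemma acoord_surj v : v \in socle_space -> exists u, acoord u = v.
Proof.
case/seq_coord_span => k ->; rewrite size_map.
exists (\sum_(i < size socle_pairs)
  to_algebra ((k i)%:MP * tset K (min_join (nth (set0, 0) socle_pairs i)))).
rewrite raddf_sum; apply: eq_bigr => i _ /=.
have : nth (set0, 0) socle_pairs i \in socle_pairs by rewrite mem_nth.
rewrite mem_enum inE => /socle_pairP[adq _].
rewrite acoord_to_algebra mul_mpolyC linearZ /= -acoord_to_algebra.
by rewrite acoord_min_join // (nth_map (set0, 0)).
Qed.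

(** Ring coefficients act on the socle through their constant terms, so generation over the ring
    amounts to spanning over K. *)
Lemma generates_socleP us :
  generates us (@socle K G) <-> <<map acoord us>>%VS = socle_space.
Proof.
split=> [gen|span_us].
  have sus i : (i < size us)%N -> socle us`_i.
    move=> ius; apply/gen; exists (fun j => (j == i)%:R).
    rewrite (bigD1 (Ordinal ius)) //= eqxx big1 => [|j ji].
      by rewrite addr0 /to_algebra rmorph1 mul1r.
    rewrite -[_ == i]/(j == Ordinal ius) (negPf ji).
    by rewrite /to_algebra rmorph0 mul0r.
  apply/eqP; rewrite eqEsubv; apply/andP; split.
    apply/span_subvP => v /mapP[u uus ->]; apply/socleP.
    by rewrite -(nth_index 0 uus); apply: sus; rewrite index_mem.
  apply/subvP => v vS; have [u uv] := acoord_surj vS; subst v.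
  have /socleP/gen[c ->] := vS; rewrite acoord_comb //.
  rewrite memv_suml // => i _; rewrite memvZ // memv_span // mem_nth //.
  by rewrite size_map.
have sus i : (i < size us)%N -> socle us`_i.
  move=> ius; apply/socleP; rewrite -span_us memv_span //.
  by rewrite -(nth_map (0 : A) 0) // mem_nth // size_map.
move=> u; split=> [/socleP|[c ->]].
  rewrite -span_us => /seq_coord_span[k]; rewrite size_map => uk.
  exists (fun i => (k i)%:MP); apply: acoord_inj.
  rewrite (acoord_comb (fun i => (k i)%:MP)) // uk.
  by apply: eq_bigr => i _; rewrite mcoeffC eqxx mulr1.
apply/socleP; rewrite acoord_comb // -span_us.
rewrite memv_suml // => i _; rewrite memvZ // memv_span // mem_nth //.
by rewrite size_map.
Qed.

(* The maximal ideal kills the socle, so A-submodules of it are K-subspaces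
   and minimal generating sequences are K-bases. *)
Lemma minimal_generating_socleP us :
  minimal_generating us (@socle K G) <-> basis_of socle_space (map acoord us).
Proof.
split=> [[/generates_socleP gen min]|/andP[/eqP span_us free_us]].
  rewrite basisEdim gen subvv -gen /=.
  (* A free selection with the same span still generates, so minimality forces it to keep every
     element. *)
  have [m [sm fm mX]] := span_free_mask (map acoord us).
  have := min (mask m us) (mask_subseq m us).
  rewrite generates_socleP map_mask mX => /(_ gen) mus.
  by move: fm; rewrite -map_mask mus => /eqP ->.
split; first exact/generates_socleP.
move=> vs vs_us /generates_socleP span_vs; apply/eqP.
rewrite -(size_subseq_leqif vs_us) eqn_leq size_subseq //=.
rewrite -(size_map acoord us) -(eqP free_us) span_us -span_vs.
by rewrite -(size_map acoord vs) dim_span.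
Qed.

(** A non-zero coordinate at q comes from a parity join of class q, of size [tau q], whose monomial
    occurs in a representative homogeneous of degree d. *)
Lemma homogeneous_tau d u q : homogeneous d u -> acoord u q != 0 -> tau q = d.
Proof.
case=> f fd ->; rewrite acoord_to_algebra ffunE => /coord_neq0[J [pJ cJ]].
move: pJ; rewrite parity_joinE cJ => /eqP <-; apply: contraNeq => Jd.
by rewrite (dhomog_nemf_coeff fd) //= mdeg_mset.
Qed.

Lemma tset_homogeneous (J : {set edge G}) :
  homogeneous #|J| (to_algebra (tset K J)).
Proof. by exists (tset K J) => //; rewrite tsetE dhomogX /= mdeg_mset. Qed.

(* A homogeneous basis has in each degree at most as many elements as the
   corresponding component of the socle; equality of totals forces equality. *)
Lemma socle_degreesP (ds : seq nat) :
  socle_degrees K G ds <-> perm_eq ds [seq tau q | q <- socle_pairs].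
Proof.
have uS : uniq socle_pairs by exact: enum_uniq.
split=> [[us [/minimal_generating_socleP bas sds homus]]|].
  have free_us := basis_free bas.
  have : (exists2 s, subseq s [seq tau q | q <- socle_pairs] & perm_eq ds s).
    apply/count_subseqP => d; rewrite count_map.
    set Sd := [seq q <- socle_pairs | tau q == d].
    (* The mask selects the generators of degree d; their coordinate vectors are free and supported
       on [Sd]. *)
    pose m := [seq d' == d | d' <- ds].
    have -> : count_mem d ds = size (mask m (map acoord us)).
      by rewrite size_mask ?size_map ?sds // count_map.
    rewrite -size_filter -/Sd -(dim_span_delta K (filter_uniq _ uS)).
    rewrite -(eqP (free_mask m free_us)); apply/dimvS/span_subvP => v.
    rewrite -map_mask => /mapP[u um ->]; apply/span_deltaP => q uq.
    have usub := mem_mask um.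
    rewrite mem_filter; apply/andP; split.
      have [i [ius mi iu]] := mem_mask_nth 0 um.
      move: mi; rewrite /m (nth_map 0%N) ?sds // => /eqP id.
      by apply/eqP; apply: homogeneous_tau uq; rewrite -iu -id; apply: homus.
    have : acoord u \in socle_space.
      by apply: (basis_mem bas); rewrite map_f.
    by move/span_deltaP/(_ _ uq).
  case=> s sub pds; rewrite (perm_trans pds) //.
  suff /eqP -> : s == [seq tau q | q <- socle_pairs] by [].
  rewrite -(size_subseq_leqif sub) -(perm_size pds) sds size_map.
  rewrite -(size_map acoord us) -(eqP free_us) (span_basis bas).
  by rewrite dim_span_delta.
case/(perm_iotaP 0%N) => is_ /[!size_map] pis dsE.
(* The socle pairs are reordered so that their [tau] values match [ds] position by position. *)
pose qs := [seq nth (set0, 0) socle_pairs i | i <- is_].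
have pqs : perm_eq qs socle_pairs.
  rewrite -[X in perm_eq _ X](mkseq_nth (set0, 0)) /mkseq.
  exact: perm_map.
have {}dsE : ds = map (@tau G) qs.
  rewrite dsE -map_comp; apply/eq_in_map => i.
  rewrite (perm_mem pis) mem_iota => /andP[_ iS].
  by rewrite /= (nth_map (set0, 0)).
have adq q : q \in qs -> admits_join q.
  by rewrite (perm_mem pqs) mem_enum inE => /socle_pairP[].
exists [seq to_algebra (tset K (min_join q)) | q <- qs].
have cE : map acoord [seq to_algebra (tset K (min_join q)) | q <- qs] =
          map (@delta K Q) qs.
  rewrite -map_comp; apply/eq_in_map => q /adq; exact: acoord_min_join.
split.
- apply/minimal_generating_socleP; rewrite cE /basis_of.
  rewrite (perm_free (perm_map _ pqs)) free_delta // andbT.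
  by rewrite (eq_span (perm_mem (perm_map _ pqs))).
- by rewrite dsE !size_map.
- move=> i; rewrite size_map => iqs; rewrite dsE !(nth_map (set0, 0)) //.
  have [pq cq] := min_joinP (adq _ (mem_nth (set0, 0) iqs)).
  have := tset_homogeneous (min_join (nth (set0, 0) qs i)).
  by move: pq; rewrite parity_joinE cq => /eqP ->.
Qed.

(** The only non-zero coordinate of the monomial of J sits at its own class, so the product with
    [t_ K e] vanishes exactly when [tau] does not increase along e. *)
Lemma tset_mul_t_socle_pair (J : {set edge G}) : parity_join J ->
  (forall e, tset K J * t_ K e \in I) <-> socle_pair (jclass J).
Proof.
move=> pJ; split=> [h|/socle_pairP[_ h] e].
  apply/socle_pairP; split; first exact: admits_jclass.
  move=> e up; have /mem_idealP/(_ (flip (jclass J) e)) := h e.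
  rewrite coord_mul_t up eqxx mul1r tsetE coordX_mset pJ eqxx.
  by apply/eqP; rewrite oner_neq0.
apply/mem_idealP => r; rewrite -(flipK r e) coord_mul_t tsetE coordX_mset pJ /=.
case: (eqVneq (jclass J)) => [<-|_]; last by rewrite mulr0.
by rewrite (negPf (introN eqP (h e))) mul0r.
Qed.

(** For e outside J the product is the monomial of [e |: J], in the ideal exactly when this is not a
    parity join. One-edge extensions decide maximality, because subsets of parity joins are parity
    joins. *)
Lemma tset_mul_t_maxset (J : {set edge G}) : parity_join J ->
  (forall e, tset K J * t_ K e \in I) <-> maxset (@parity_join G) J.
Proof.
move=> pJ; split=> [h|/maxsetP[_ maxJ] e].
  apply/maxsetP; split=> // L pL JL; apply/eqP; rewrite eqEsubset JL andbT.
  apply: contraT => /subsetPn[e eL eJ]; have := h e.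
  rewrite -tset_setU1 // tset_idealE => /negP[].
  by apply: sub_parity_join pL; rewrite subUset sub1set eL.
have [eJ|eJ] := boolP (e \in J); first exact: tset_mul_t_mem.
rewrite -tset_setU1 // tset_idealE; apply: contra eJ => /maxJ.
by move=> /(_ (subsetUr _ _)) <-; rewrite setU11.
Qed.

End EulerianAlgebra.

(** * Reduced parity joins matched with socle pairs *)

(** [jclass] is a bijection from the selected joins onto the socle pairs and turns size into [tau].
    The predicate P stays abstract to cover both annihilation by the variables and maximality. *)
Lemma perm_reduced_joins (G : simple_graph) (s : seq (edge G))
    (P : pred {set edge G}) :
  edge_ordering s ->
  (forall J, reduced_parity_join s J -> P J = socle_pair (jclass J)) ->
  perm_eq [seq #|J| | J : {set edge G} <-
             enum [set J : {set edge G} | reduced_parity_join s J && P J]]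
          [seq tau q | q <- socle_pairs G].
Proof.
move=> sE PE; set R := enum _.
have RP J : J \in R -> reduced_parity_join s J && P J by rewrite mem_enum inE.
have -> : [seq #|J| | J : {set edge G} <- R] = map (@tau G) (map (@jclass G) R).
  rewrite -map_comp; apply/eq_in_map => J /RP/andP[/andP[pJ _] _].
  by move: pJ; rewrite parity_joinE => /eqP.
apply: perm_map; apply: uniq_perm; rewrite ?enum_uniq //.
  rewrite map_inj_in_uniq ?enum_uniq // => J L /RP/andP[rJ _] /RP/andP[rL _].
  exact: (reduced_parity_join_inj sE).
move=> q; rewrite mem_enum inE; apply/mapP/idP.
  by case=> J /RP/andP[rJ PJ] ->; rewrite -PE.
move=> sq; have [adq _] := socle_pairP _ sq.
have [J rJ cJ] := reduced_parity_join_exists sE adq.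
by exists J => //; rewrite mem_enum inE rJ PE // cJ.
Qed.

Theorem theorem3p4 (G : simple_graph) (K : fieldType) (hE : edge_set G != set0) :
  (forall ds : seq nat,
     socle_degrees K G ds <->
     perm_eq ds [seq tau Tp | Tp <- enum [set Tp | @socle_pair G Tp]])
  /\
  (forall s : seq (edge G), edge_ordering s ->
     [/\ forall ds : seq nat,
           socle_degrees K G ds <->
           perm_eq ds
             [seq #|J| | J : {set edge G} <- enum [set J : {set edge G} |
                reduced_parity_join s J &&
                [forall e, tset K J * t_ K e \in eulerian_ideal K G]]],
         forall ds : seq nat,
           socle_degrees K G ds <->
           perm_eq ds
             [seq #|J| | J : {set edge G} <- enum [set J : {set edge G} |
                reduced_parity_join s J && maxset (@parity_join G) J]]
       & forall J : {set edge G}, reduced_parity_join s J ->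
           (forall e, tset K J * t_ K e \in eulerian_ideal K G) <->
           maxset (@parity_join G) J]).
Proof.
split=> [ds|s sE]; first exact: socle_degreesP.
have reduced_parity J : reduced_parity_join s J -> parity_join J by case/andP.
split=> [ds|ds|J /reduced_parity]; last exact: tset_mul_t_maxset.
- rewrite socle_degreesP (permPr (perm_reduced_joins sE _)) // => J.
  move=> /reduced_parity pJ; apply/forallP/idP.
    by move/(tset_mul_t_socle_pair K pJ).
  by move/(tset_mul_t_socle_pair K pJ).
- rewrite socle_degreesP (permPr (perm_reduced_joins sE _)) // => J.
  move=> /reduced_parity pJ; apply/idP/idP.
    by move/(tset_mul_t_maxset K pJ)/(tset_mul_t_socle_pair K pJ).
  by move/(tset_mul_t_socle_pair K pJ)/(tset_mul_t_maxset K pJ).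
Qed.
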